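(* Let $x_1,\dots,x_k$ and $y_1,\dots,y_k$ be points in $\mathbb{R}^n$ such that $\|y_i-y_j\|_2\le\|x_i-x_j\|_2$ for all $i,j\in\{1,\dots,k\}$. Then the capacity of the additive white Gaussian noise channel with input alphabet $\{y_1,\dots,y_k\}$ is at most the capacity of the additive white Gaussian noise channel with input alphabet $\{x_1,\dots,x_k\}$: $$\mathcal{C}(\{y_1,\dots,y_k\})\;\le\;\mathcal{C}(\{x_1,\dots,x_k\}).$$
   Context: For a finite set $K\subset\mathbb{R}^n$, the additive white Gaussian noise channel with alphabet $K$ is the channel in which the receiver obtains the random point $x+Z$ when the sender sends $x\in K$, where $Z$ is a standard Gaussian random vector in $\mathbb{R}^n$. Its capacity $\mathcal{C}(K)$ is the optimal rate at which information can be reliably transmitted across the channel, which by Shannon's theorem is given by $$\mathcal{C}(K)=\sup_X I(X;X+Z),$$ where the supremum is over all random vectors $X$ taking values in $K$, $Z$ is independent of $X$, and the mutual information is $I(X;X+Z)=h(X+Z)-h(X+Z\mid X)=h(X+Z)-h(Z)$. Here $h(W)=-\int f\log f\,dx$ is the Shannon–Boltzmann entropy of a random vector $W$ with density $f$ with respect to Lebesgue measure. *)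

(* Defs.v *)
From HB Require Import structures.
From mathcomp Require Import all_boot all_order all_algebra.
From mathcomp Require Import all_classical all_reals all_analysis.

Set Implicit Arguments.
Unset Strict Implicit.
Unset Printing Implicit Defensive.
Import Order.TTheory GRing.Theory Num.Theory.
Import numFieldNormedType.Exports.

Local Open Scope classical_set_scope.
Local Open Scope ring_scope.

(* R^n is [n.-tuple R], with the product sigma-algebra that the library puts
   on tuples. *)

Definition eucl_dist (R : realType) (n : nat) (u v : n.-tuple R) : R :=
  Num.sqrt (\sum_(i < n) (tnth u i - tnth v i) ^+ 2).

Definition vadd (R : realType) (n : nat) (u v : n.-tuple R) : n.-tuple R :=
  [tuple tnth u i + tnth v i | i < n].

Definition tcons (R : realType) (n : nat)
    (p : measurableTypeR R * n.-tuple R) : n.+1.-tuple R :=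
  [the n.+1.-tuple R of p.1 :: p.2].

Lemma measurable_tcons (R : realType) (n : nat) :
  measurable_fun [set: measurableTypeR R * n.-tuple R] (@tcons R n).
Proof. exact: measurable_cons. Qed.

Section cons_measure.
Context (R : realType) (n : nat).
Variable mu : {sigma_finite_measure set (n.-tuple R) -> \bar R}.

Definition cons_measure : set (n.+1.-tuple R) -> \bar R :=
  pushforward (@lebesgue_measure R \x mu)%E (@tcons R n).

Let pre (A : set (n.+1.-tuple R)) :
  measurable A -> measurable (@tcons R n @^-1` A).
Proof.
by move=> mA; rewrite -[X in measurable X]setTI; exact: measurable_tcons.
Qed.

Let cons_measure0 : cons_measure set0 = 0%E.
Proof. by rewrite /cons_measure /pushforward preimage_set0 measure0. Qed.

Let cons_measure_ge0 A : (0 <= cons_measure A)%E.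
Proof. by rewrite /cons_measure /pushforward; apply: measure_ge0. Qed.

Let cons_measure_sigma_additive : semi_sigma_additive cons_measure.
Proof.
move=> F mF tF mUF; rewrite /cons_measure /pushforward preimage_bigcup.
apply: measure_semi_sigma_additive.
- by move=> k; apply: pre; exact: mF.
- apply/trivIsetP => /= i j _ _ ij; rewrite -preimage_setI.
  by move/trivIsetP : tF => /(_ _ _ _ _ ij) ->//; rewrite preimage_set0.
- by rewrite -preimage_bigcup; exact: pre.
Qed.

HB.instance Definition _ := isMeasure.Build _ _ _ cons_measure
  cons_measure0 cons_measure_ge0 cons_measure_sigma_additive.

Let tuncons (t : n.+1.-tuple R) : measurableTypeR R * n.-tuple R :=
  (thead t, [tuple of behead t]).

Let measurable_tuncons : measurable_fun setT tuncons.
Proof.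
apply: measurable_fun_pair; first exact: measurable_tnth.
exact: measurable_behead.
Qed.

Let tconsK : cancel (@tcons R n) tuncons.
Proof.
by move=> [x t]; congr (_, _); apply/val_inj.
Qed.

Let cons_measure_sigma_finite : sigma_finite setT cons_measure.
Proof.
have [F FT Foo] :=
  lebesgue_integral_fubini.product_measure_sigma_finite_subproof
    (@lebesgue_measure R) mu.
exists (fun k => tuncons @^-1` F k).
  by rewrite -preimage_bigcup -FT preimage_setT.
move=> k; have [mF Fk] := Foo k; split.
  by rewrite -[X in measurable X]setTI; exact: measurable_tuncons.
rewrite /cons_measure /pushforward -comp_preimage.
by rewrite (_ : _ \o _ = id) ?preimage_id//; apply/funext => p; exact: tconsK.
Qed.

HB.instance Definition _ := @Measure_isSigmaFinite.Build _ _ _ cons_measure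
  cons_measure_sigma_finite.

End cons_measure.

(* Lebesgue measure on R^n, as the n-fold product of Lebesgue measure on R. *)
Fixpoint lebesgue_tuple (R : realType) (n : nat) :
    {sigma_finite_measure set (n.-tuple R) -> \bar R} :=
  match n with
  | 0 => \d_([tuple] : 0.-tuple R)
  | m.+1 => cons_measure (lebesgue_tuple R m)
  end.

Section random_vectors.
Context d (T : measurableType d) (R : realType) (n : nat).
Variable P : probability T R.
Implicit Types X Z W : {RV P >-> n.-tuple R}.

Definition rvadd X Z : T -> n.-tuple R := fun w => vadd (X w) (Z w).

Lemma measurable_rvadd X Z : measurable_fun setT (rvadd X Z).
Proof.
apply/measurable_fun_tnthP => i.
rewrite (_ : _ \o _ = (fun w => tnth (X w) i + tnth (Z w) i)); last first.
  by apply/funext => w /=; rewrite tnth_mktuple.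
by apply: measurable_realfun.measurable_funD;
  apply: (measurableT_comp (measurable_tnth i)); exact: measurable_funPT.
Qed.

HB.instance Definition _ X Z :=
  isMeasurableFun.Build _ _ _ _ (rvadd X Z) (measurable_rvadd X Z).

Definition independent X Z : Prop :=
  forall A B, measurable A -> measurable B ->
    P (X @^-1` A `&` Z @^-1` B) = (P (X @^-1` A) * P (Z @^-1` B))%E.

Definition standard_gaussian Z : Prop :=
  forall A, measurable A ->
    distribution P Z A =
      (\int[lebesgue_tuple R n]_(z in A)
         (\prod_(i < n) normal_pdf 0 1 (tnth z i))%:E)%E.

Definition density W : n.-tuple R -> \bar R :=
  Radon_Nikodym (charge_of_finite_measure (distribution P W))
    (lebesgue_tuple R n).

(* [lne 0 = -oo] and [0 * -oo = 0], so the integrand vanishes where the density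
   does.  If W has no density, [Radon_Nikodym] is constantly [-oo] and the
   entropy is [-oo]. *)
Definition entropy W : \bar R :=
  (- \int[lebesgue_tuple R n]_x (density W x * lne (density W x)))%E.

(* The mutual information of X and X + Z, for Z independent of X. *)
Definition awgn_information X Z : \bar R :=
  (entropy (rvadd X Z) - entropy Z)%E.

End random_vectors.

(* The supremum ranges over all probability spaces carrying X and Z. *)
Definition capacity (R : realType) (n : nat) (K : set (n.-tuple R)) : \bar R :=
  ereal_sup [set I : \bar R |
    exists (d : measure_display) (T : measurableType d) (P : probability T R)
           (X Z : {RV P >-> n.-tuple R}),
      [/\ forall w, K (X w), standard_gaussian Z, independent X Z
        & I = awgn_information X Z]].

(* Main.v *)
Require Import Defs.
From HB Require Import structures.
From mathcomp Require Import all_boot all_order all_algebra.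
From mathcomp Require Import ring lra.
From mathcomp Require Import all_classical all_reals all_analysis.
From mathcomp Require Import measurable_realfun.

(** Fix the law of the index of the input: let the input be [x i] (resp. [y i])
with probability [p i].  The output of the channel then has as density the
Gaussian mixture [f_x = \sum_i p i * G (x i)], where [G a] is the standard
Gaussian density centred at [a].  An input with values in [range y] becomes an
input with values in [range x] by keeping the index and the noise, so it is
enough to compare entropies for a fixed [p]
([neg_entropy_mixture_contraction]):
[\int f_x ln f_x <= \int f_y ln f_y].

The contraction is realized by a path in twice the dimension.  The points
[(a x i, b y i)], with [(a, b)] running on the unit circle from [(1, 0)] to
[(0, 1)], have pairwise squared distances
[a^2 |x i - x j|^2 + b^2 |y i - y j|^2], which decrease along the path.  At the
two ends the mixture is the product of [f_x], resp. [f_y], with a Gaussian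
density, so its negative entropy is that of [f_x], resp. [f_y], up to the same
additive constant.

The path is followed in small steps, without differentiating any integral.
If [x i] moves to [x i + delta i] and
[<x i - x j, delta i - delta j> <= 0] for all [i] and [j], then
[neg_entropy_step] says that [\int f ln f] loses at most
[1/2 * \sum_i p i |delta i|^2].  Indeed, if [f] and [g] are the mixtures before
and after the move, then
[\int g ln g >= \int g ln f = \sum_i p i \int G (x i)(z) ln f(z + delta i) dz]
by the Gibbs inequality and by translation.  Since [f(z + delta i)] is a
weighted sum of the terms [p j * G (x j)(z)], the weights being exponentials of
[<x j - z, delta i> - |delta i|^2 / 2], concavity of the logarithm bounds
[ln f(z + delta i)] from below; after summation over [i] the cross terms have a
sign by the hypothesis on the moves ([sum_ln_sum_expR_ge]), and the remaining
first moments of the Gaussian densities vanish.  With [N] steps of length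
[O(1/N)] the total loss is [O(1/N)], and [N] tends to infinity.

The Euclidean spaces enter only through [gaussian_coords], which records
coordinate functions, translations that preserve the measure, and Tonelli's
theorem for products of functions of one coordinate. *)

Set Implicit Arguments.
Unset Strict Implicit.
Unset Printing Implicit Defensive.
Import Order.TTheory GRing.Theory Num.Theory.
Import numFieldNormedType.Exports.

Local Open Scope classical_set_scope.
Local Open Scope ring_scope.

(** * Weighted sums of exponentials *)

Section finite_sums.
Context {R : realType} {k : nat}.
Implicit Types (g e : 'I_k -> R).

(** Jensen inequality for the concave function [ln], with the weights [g]
normalized by their sum. *)
Lemma ln_sum_expR_ge g e : (forall j, 0 <= g j) -> 0 < \sum_j g j ->
  ln (\sum_j g j) + (\sum_j g j * e j) / (\sum_j g j)
    <= ln (\sum_j g j * expR (e j)).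
Proof.
move=> g0 S0; set S := \sum_j g j; set m := (X in _ + X).
(* The convex function [expR] lies above its tangent at the mean [m]. *)
have h j : g j * (expR m * (1 + (e j - m))) <= g j * expR (e j).
  apply: ler_wpM2l => //.
  have -> : expR (e j) = expR m * expR (e j - m).
    by rewrite -expRD addrC subrK.
  by apply: ler_wpM2l; [exact: expR_ge0|exact: expR_ge1Dx].
have hS : S * expR m <= \sum_j g j * expR (e j).
  apply: le_trans (ler_sum _ (fun j _ => h j)).
  have -> : \sum_j g j * (expR m * (1 + (e j - m))) =
      expR m * ((1 - m) * S + \sum_j g j * e j).
    rewrite mulrDr mulrA !mulr_sumr -big_split/=.
    by apply: eq_bigr => j _; ring.
  rewrite le_eqVlt; apply/orP; left; apply/eqP.
  have -> : \sum_j g j * e j = m * S by rewrite /m divfK// gt_eqF.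
  ring.
have E : ln S + m = ln (S * expR m).
  by rewrite lnM ?posrE ?expR_gt0// expRK.
by rewrite E ler_ln ?posrE// ?mulr_gt0 ?expR_gt0// (lt_le_trans _ hS)// mulr_gt0
  ?expR_gt0.
Qed.

(** The discrete heart of the step estimate.  After Jensen the double sum of the
[g i * g j * e i j] appears; symmetrizing it in [i] and [j] allows the
hypothesis on [e] to replace it by the diagonal terms. *)
Lemma sum_ln_sum_expR_ge g (e : 'I_k -> 'I_k -> R) :
  (forall j, 0 <= g j) -> 0 < \sum_j g j ->
  (forall i j, e i i + e j j <= e i j + e j i) ->
  (\sum_j g j) * ln (\sum_j g j) + \sum_i g i * e i i
    <= \sum_i g i * ln (\sum_j g j * expR (e i j)).
Proof.
move=> g0 S0 he; set S := \sum_j g j.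
have h i : g i * (ln S + (\sum_j g j * e i j) / S) <=
           g i * ln (\sum_j g j * expR (e i j)).
  by apply: ler_wpM2l => //; exact: ln_sum_expR_ge.
apply: le_trans (ler_sum _ (fun i _ => h i)).
have -> : \sum_i g i * (ln S + (\sum_j g j * e i j) / S) =
    S * ln S + (\sum_i \sum_j g i * g j * e i j) / S.
  rewrite !mulr_suml -big_split/=; apply: eq_bigr => i _.
  by rewrite mulrDr mulrA mulr_sumr; under [in RHS]eq_bigr do rewrite -mulrA.
rewrite lerD2l ler_pdivlMr//.
have E1 : (\sum_i g i * e i i) * S = \sum_i \sum_j g i * g j * e i i.
  rewrite mulr_suml; apply: eq_bigr => i _.
  by rewrite mulr_sumr; apply: eq_bigr => j _; ring.
have E2 : (\sum_i g i * e i i) * S = \sum_i \sum_j g i * g j * e j j.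
  rewrite E1 exchange_big/=; apply: eq_bigr => i _; apply: eq_bigr => j _; ring.
have E3 : \sum_i \sum_j g i * g j * e i j = \sum_i \sum_j g i * g j * e j i.
  rewrite exchange_big/=; apply: eq_bigr => i _; apply: eq_bigr => j _; ring.
rewrite -(ler_pM2l (_ : 0 < 2 :> R))// !mulr_natl !mulr2n.
rewrite {1}E1 E2 {2}E3 -!big_split/=; apply: ler_sum => i _.
rewrite -!big_split/=; apply: ler_sum => j _.
by rewrite -!mulrDr; apply: ler_wpM2l; rewrite ?mulr_ge0.
Qed.

End finite_sums.

(** * Lebesgue measure and the Gaussian density on the line *)

Section lebesgue_line.
Context {R : realType}.
Local Notation mu := (@lebesgue_measure R).

Lemma ge0_integral_lebesgue_shift (a : R) (F : measurableTypeR R -> \bar R) :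
  measurable_fun [set: measurableTypeR R] F -> (forall t, 0 <= F t)%E ->
  (\int[mu]_t F (t + a)%R = \int[mu]_t F t)%E.
Proof.
move=> mF F0.
pose s : measurableTypeR R -> measurableTypeR R := fun t => t + a.
have ms : measurable_fun [set: measurableTypeR R] s.
  by apply: measurable_realfun.measurable_funD.
transitivity (\int[pushforward mu s]_t F t)%E.
  by rewrite ge0_integral_pushforward//.
apply: eq_measure_integral => A mA _.
apply/esym/lebesgue_measure_unique => // _ [[b c]] _ <-.
rewrite /= /pushforward.
have -> : s @^-1` `]b, c] = `]b - a, c - a]%classic.
  by apply/seteqP; split => t /=; rewrite !in_itv/= /s ltrBlDr lerBrDr.
rewrite !lebesgue_measure_itv/= !lte_fin ltrD2r; case: ifP => // _.
by rewrite -!EFinD; congr (_%:E); ring.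
Qed.

End lebesgue_line.

Section gaussian_line.
Context {R : realType}.
Local Notation mu := (@lebesgue_measure R).
Local Notation g := (normal_pdf 0 1 : measurableTypeR R -> R).

Lemma normal_pdf01E t : g t = normal_peak 1 * expR (- 2^-1 * t ^+ 2).
Proof.
rewrite normal_pdfE ?oner_neq0// /normal_fun subr0 expr1n; congr (_ * expR _).
by rewrite mulr2n -[1 + 1]/2%:R mulNr mulNr mulrC.
Qed.

(** The bound [u * expR (- u) <= 1] at [u = t^2 / 4] dominates [t^2] times the
standard Gaussian density by a multiple of the density of variance [2]. *)
Lemma integrable_gaussian_sqr :
  mu.-integrable setT (fun t : measurableTypeR R => (t ^+ 2 * g t)%:E).
Proof.
pose s : R := Num.sqrt 2.
have s2 : s ^+ 2 = 2 by rewrite sqr_sqrtr.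
have s0 : s != 0 by rewrite sqrtr_eq0 -ltNge.
pose C := normal_peak (1:R) * (4 * (normal_peak s)^-1).
apply: (@le_integrable _ _ _ _ setT _ _ (fun t : measurableTypeR R =>
  (C * normal_pdf 0 s t)%:E)) => //.
- apply/measurable_EFinP; apply: measurable_realfun.measurable_funM.
    exact: measurable_funX.
  exact: measurable_normal_pdf.
- move=> t _;
    rewrite !abse_EFin lee_fin !ger0_norm
    ?(sqr_ge0, mulr_ge0, normal_pdf_ge0)//;
    rewrite /C ?mulr_ge0 ?normal_peak_ge0 ?invr_ge0 ?normal_peak_ge0//.
  rewrite normal_pdf01E normal_pdfE// /normal_fun subr0 s2 -/s.
  have -> : normal_peak 1 * (4 / normal_peak s) *
    (normal_peak s * expR (- t ^+ 2 / (2 *+ 2))) =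
      normal_peak 1 * (4 * expR (- t ^+ 2 / (2 *+ 2))).
    by field; rewrite gt_eqF// normal_peak_gt0.
  rewrite mulrCA; apply: ler_wpM2l; first exact: normal_peak_ge0.
  have -> : - 2^-1 * t ^+ 2 = - (t ^+ 2 / 4) - t ^+ 2 / 4 by field.
  have -> : - t ^+ 2 / (2 *+ 2) = - (t ^+ 2 / 4) by field.
  rewrite expRD mulrCA [leRHS]mulrC; apply: ler_wpM2l; first exact: expR_ge0.
  rewrite expRN ler_pdivrMr ?expR_gt0//.
  have := expR_ge1Dx (t ^+ 2 / 4); lra.
- exact: (integrableZl measurableT C (integrable_normal_pdf 0 s)).
Qed.

Lemma integral_gaussian_sqr : exists v : R,
  (\int[mu]_t (t ^+ 2 * g t)%:E = v%:E)%E.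
Proof.
have /integrable_fin_num -/(_ measurableT) := integrable_gaussian_sqr.
by move/fineK => <-; exists (fine (\int[mu]_t (t ^+ 2 * g t)%:E)).
Qed.

(** By symmetry the positive and the negative part of the variable have the
same finite mean. *)
Lemma integral_gaussian_pos : exists v : R,
  (\int[mu]_t (Num.max t 0 * g t)%:E = v%:E)%E /\
  (\int[mu]_t (Num.max (- t) 0 * g t)%:E = v%:E)%E.
Proof.
have m1 : measurable_fun [set: measurableTypeR R] (fun t =>
  (Num.max t 0 * g t)%:E).
  apply/measurable_EFinP; apply: measurable_realfun.measurable_funM.
    by apply: measurable_maxr.
  exact: measurable_normal_pdf.
have i1 : mu.-integrable setT (fun t : measurableTypeR R =>
  (Num.max t 0 * g t)%:E).
  apply: (@le_integrable _ _ _ _ setT _ _ (fun t : measurableTypeR R =>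
    (g t)%:E + (t ^+ 2 * g t)%:E)%E) => //.
  - move=> t _; rewrite -EFinD !abse_EFin lee_fin.
    rewrite !ger0_norm ?(sqr_ge0, addr_ge0, mulr_ge0, normal_pdf_ge0)//;
      last first.
      by rewrite le_max lexx orbT.
    rewrite -{2}[g t]mul1r -mulrDl ler_wpM2r ?normal_pdf_ge0// ge_max;
      apply/andP; split; nra.
  - by apply: integrableD => //;
      [exact: integrable_normal_pdf|exact: integrable_gaussian_sqr].
have /fineK E : (\int[mu]_t (Num.max t 0 * g t)%:E)%E \is a fin_num.
  exact: integrable_fin_num.
exists (fine (\int[mu]_t (Num.max t 0 * g t)%:E)%E); split; first by rewrite E.
rewrite E.
pose N : measurableTypeR R -> measurableTypeR R := fun t => - t.
have mN : measurable_fun [set: measurableTypeR R] N by exact: oppr_measurable.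
transitivity (\int[pushforward mu N]_t (Num.max t 0 * g t)%:E)%E; last first.
  by apply: eq_measure_integral => A mA _; exact: lebesgue_measureN.
rewrite (ge0_integral_pushforward mN _ measurableT m1); last first.
  by move=> t _; rewrite lee_fin mulr_ge0 ?normal_pdf_ge0// le_max lexx orbT.
by apply: eq_integral => t _ /=; rewrite /N !normal_pdf01E sqrrN.
Qed.

End gaussian_line.

(** * Gaussian kernels and mixtures on a space with coordinates *)

(** The part of the structure of a Euclidean space with Lebesgue measure that
the entropy estimate uses: finitely many measurable coordinates [c], measurable
translations [tr] that act on the coordinates and preserve the integrals of
nonnegative functions, and the factorization of the integral of a product of
nonnegative functions of the single coordinates.  The index set is any finite
type, so that a product of two such spaces is indexed by a sum type. *)
Record gaussian_coords d (T : measurableType d) (R : realType)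
    (mu : {measure set T -> \bar R}) (I : finType)
    (c : I -> T -> R) (tr : (I -> R) -> T -> T) : Prop := GaussianCoords {
  gc_meas : forall l, measurable_fun setT (c l) ;
  gc_trm : forall a, measurable_fun setT (tr a) ;
  gc_trE : forall a l z, c l (tr a z) = c l z + a l ;
  gc_inv : forall a (F : T -> \bar R), measurable_fun setT F ->
    (forall z, 0 <= F z)%E -> (\int[mu]_z F (tr a z) = \int[mu]_z F z)%E ;
  gc_prod : forall (h : I -> measurableTypeR R -> R) (v : I -> R),
    (forall l, measurable_fun setT (h l)) -> (forall l t, 0 <= h l t) ->
    (forall l, \int[@lebesgue_measure R]_t (h l t)%:E = (v l)%:E)%E ->
    (\int[mu]_z (\prod_l h l (c l z))%:E = (\prod_l v l)%:E)%E }.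

Section gaussian_mixtures.
Context d (T : measurableType d) (R : realType).
Context (mu : {measure set T -> \bar R}).
Context (I : finType) (c : I -> T -> R) (tr : (I -> R) -> T -> T).
Implicit Types (a b : I -> R) (z : T) (F : T -> R).

(** The standard Gaussian density centred at the point with coordinates [a]. *)
Definition gkernel a z : R := \prod_l normal_pdf 0 1 (c l z - a l).

(** The density of a Gaussian noise added to a random point that is [x i] with
probability [p i]. *)
Definition mixture k (p : 'I_k -> R) (x : 'I_k -> I -> R) z : R :=
  \sum_i p i * gkernel (x i) z.

(** The opposite of the Shannon-Boltzmann entropy of the density [F]. *)
Definition neg_entropy F : R := \int[mu]_z (F z * ln (F z)).

Local Notation integ F := (mu.-integrable setT (EFin \o F)).

(* The logarithm of the peak of the kernel. *)
Let kappa : R := \sum_(l : I) ln (normal_peak (1 : R)).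
(* The quadratic weight to which all integrands are compared. *)
Let Q z : R := 1 + \sum_l c l z ^+ 2.

Lemma gkernelE a z :
  gkernel a z = expR (kappa - 2^-1 * \sum_l (c l z - a l) ^+ 2).
Proof.
rewrite /kappa mulr_sumr -sumrB expR_sum; apply: eq_bigr => l _.
rewrite normal_pdf01E expRD lnK ?posrE ?normal_peak_gt0 ?oner_neq0//.
by rewrite mulNr.
Qed.

Lemma gkernel_gt0 a z : 0 < gkernel a z.
Proof. by rewrite gkernelE expR_gt0. Qed.

Lemma gkernel_ge0 a z : 0 <= gkernel a z.
Proof. exact/ltW/gkernel_gt0. Qed.

Lemma exists_weight_gt0 k (p : 'I_k -> R) : (forall i, 0 <= p i) ->
  \sum_i p i = 1 -> exists i, 0 < p i.
Proof.
move=> p0 p1; apply/existsP.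
apply: contraPT (oner_neq0 R) => /existsPn h; apply/negP/negPn.
rewrite -p1 big1// => i _; apply/eqP; rewrite eq_le p0 andbT leNgt; exact: h.
Qed.

Lemma mixture_gt0 k (p : 'I_k -> R) x z : (forall i, 0 <= p i) ->
  \sum_i p i = 1 -> 0 < mixture p x z.
Proof.
move=> p0 p1; have [i pi0] := exists_weight_gt0 p0 p1.
rewrite /mixture (bigD1 i)//= ltr_wpDr//;
  last by rewrite mulr_gt0// gkernel_gt0.
by apply: sumr_ge0 => j _; rewrite mulr_ge0// gkernel_ge0.
Qed.

Hypothesis H : gaussian_coords mu c tr.

Let Q_ge1 z : 1 <= Q z.
Proof. by rewrite lerDl; apply: sumr_ge0 => l _; exact: sqr_ge0. Qed.

Lemma measurable_gkernel a : measurable_fun setT (gkernel a).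
Proof.
apply: measurable_prod => l _.
apply: (measurableT_comp (measurable_normal_pdf 0 1)).
by apply: measurable_realfun.measurable_funB => //; exact: (gc_meas H).
Qed.

Lemma measurable_mixture k (p : 'I_k -> R) x :
  measurable_fun setT (mixture p x).
Proof.
apply: measurable_sum => i; apply: measurable_realfun.measurable_funM => //.
exact: measurable_gkernel.
Qed.

Let measurable_Q : measurable_fun setT Q.
Proof.
apply: measurable_realfun.measurable_funD => //.
by apply: measurable_sum => l; apply: measurable_funX; exact: (gc_meas H).
Qed.

Lemma gkernel_tr a b z : gkernel a (tr b z) = gkernel (fun l => a l - b l) z.
Proof. by apply: eq_bigr => l _; rewrite (gc_trE H); congr normal_pdf; ring.
Qed.

(** Translation invariance extends to integrals of arbitrary sign, without any
integrability condition. *)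
Lemma integral_tr b (F : T -> \bar R) : measurable_fun setT F ->
  (\int[mu]_z F (tr b z) = \int[mu]_z F z)%E.
Proof.
move=> mF; rewrite integralE [RHS]integralE; congr (_ - _)%E.
- rewrite -[RHS](gc_inv H b); [|exact: measurable_funepos|by []].
  by apply: eq_integral => z _; rewrite !funeposE.
- rewrite -[RHS](gc_inv H b); [|exact: measurable_funeneg|by []].
  by apply: eq_integral => z _; rewrite !funenegE.
Qed.

Lemma integral_gkernel a : (\int[mu]_z (gkernel a z)%:E = 1)%E.
Proof.
rewrite -(integral_tr a); last exact/measurable_EFinP/measurable_gkernel.
under eq_integral => z _.
  rewrite gkernel_tr /gkernel; under eq_bigr do rewrite subrr subr0.
  over.
rewrite (gc_prod H (h := fun=> normal_pdf 0 1) (v := fun=> 1)).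
- by rewrite big1.
- by move=> _; exact: measurable_normal_pdf.
- by move=> *; exact: normal_pdf_ge0.
- by move=> _; exact: integral_normal_pdf.
Qed.

Lemma integral_gkernel_coord (h : measurableTypeR R -> R) v l :
  measurable_fun setT h -> (forall t, 0 <= h t) ->
  (\int[@lebesgue_measure R]_t (h t * normal_pdf 0 1 t)%:E = v%:E)%E ->
  (\int[mu]_z (h (c l z) * gkernel (fun=> 0%R) z)%:E = v%:E)%E.
Proof.
move=> mh h0 hv.
pose k m (t : measurableTypeR R) : R :=
  (if m == l then h t else 1) * normal_pdf 0 1 t.
transitivity (\int[mu]_z (\prod_m k m (c m z))%:E)%E.
  apply: eq_integral => z _; congr (_%:E).
  rewrite /k big_split/= -big_mkcond/= big_pred1_eq; congr (_ * _).
  by apply: eq_bigr => m _; rewrite subr0.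
rewrite (gc_prod H (h := k) (v := fun m => if m == l then v else 1)).
- by rewrite -big_mkcond/= big_pred1_eq.
- move=> m; apply: measurable_realfun.measurable_funM; first by case: eqP.
  exact: measurable_normal_pdf.
- by move=> m t; rewrite mulr_ge0 ?normal_pdf_ge0//; case: eqP.
- move=> m; rewrite /k; case: eqP => // _.
  by under eq_integral do rewrite mul1r; exact: integral_normal_pdf.
Qed.

Let integ_Q0 : integ (fun z => gkernel (fun=> 0) z * Q z).
Proof.
rewrite (_ : _ \o _ = fun z => ((gkernel (fun=> 0%R) z)%:E +
    \sum_l (c l z ^+ 2 * gkernel (fun=> 0%R) z)%:E)%E); last first.
  apply/funext => z /=; rewrite sumEFin -EFinD -mulr_suml /Q; congr (_%:E);
    ring.
apply: integrableD => //.
  apply/integrableP; split; first exact/measurable_EFinP/measurable_gkernel.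
  under eq_integral do rewrite gee0_abs ?lee_fin ?gkernel_ge0//.
  by rewrite integral_gkernel ltry.
apply: integrable_sum => // l _.
apply/integrableP; split.
  apply/measurable_EFinP; apply: measurable_realfun.measurable_funM.
    by apply: measurable_funX; exact: (gc_meas H).
  exact: measurable_gkernel.
under eq_integral do rewrite abse_EFin ger0_norm
  ?(sqr_ge0, mulr_ge0, gkernel_ge0)//.
have [v hv] := @integral_gaussian_sqr R.
have m2 : measurable_fun [set: measurableTypeR R]
    (fun t : measurableTypeR R => (t : R) ^+ 2).
  exact: measurable_funX.
by rewrite (integral_gkernel_coord l m2 (fun t => sqr_ge0 _) hv) ltry.
Qed.

Let Q_tr b : exists2 C : R, 0 <= C & forall z, Q (tr b z) <= C * Q z.
Proof.
exists (2 + 2 * \sum_l b l ^+ 2).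
  by rewrite addr_ge0// mulr_ge0// sumr_ge0// => l _; exact: sqr_ge0.
move=> z; rewrite /Q.
have h : \sum_l c l (tr b z) ^+ 2 <=
    2 * \sum_l c l z ^+ 2 + 2 * \sum_l b l ^+ 2.
  rewrite !mulr_sumr -big_split/=; apply: ler_sum => l _; rewrite (gc_trE H).
  have := sqr_ge0 (c l z - b l); lra.
have B0 : 0 <= \sum_l b l ^+ 2 by apply: sumr_ge0 => l _; exact: sqr_ge0.
have C0 : 0 <= \sum_l c l z ^+ 2 by apply: sumr_ge0 => l _; exact: sqr_ge0.
have := mulr_ge0 B0 C0; nra.
Qed.

Let integ_Q a : integ (fun z => gkernel a z * Q z).
Proof.
have mF b : measurable_fun setT (fun z => gkernel b z * Q z).
  by apply: measurable_realfun.measurable_funM => //; exact: measurable_gkernel.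
have F0 b z : 0 <= gkernel b z * Q z.
  by rewrite mulr_ge0 ?gkernel_ge0// (le_trans ler01).
apply/integrableP; split; first exact/measurable_EFinP.
rewrite -(integral_tr a); last by apply: measurableT_comp => //;
  exact/measurable_EFinP.
have [C C0 hC] := Q_tr a.
apply: (@le_lt_trans _ _ (\int[mu]_z (C%:E *
  (gkernel (fun=> 0%R) z * Q z)%:E))%E).
  apply: ge0_le_integral => //.
  - apply: measurableT_comp => //; apply/measurable_EFinP.
    by apply: (measurableT_comp (mF a)); exact: (gc_trm H).
  - by apply: measurable_funeM; apply/measurable_EFinP.
  - move=> z _ /=; rewrite ger0_norm// -EFinM lee_fin gkernel_tr.
    rewrite (_ : (fun l => a l - a l) = (fun=> 0)); last by apply/funext => l;
      rewrite subrr.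
    by rewrite mulrCA ler_wpM2l ?gkernel_ge0.
rewrite ge0_integralZl//; last 2 first.
- exact/measurable_EFinP.
- by move=> z _; rewrite lee_fin.
rewrite lte_mul_pinfty//.
have /integrableP[_] := integ_Q0.
by under eq_integral do rewrite gee0_abs ?lee_fin//=.
Qed.

(** Functions of at most quadratic growth are integrable against the kernels. *)
Lemma integrable_gkernelM a F C : measurable_fun setT F ->
  (forall z, `|F z| <= C * (1 + \sum_l c l z ^+ 2)) ->
  integ (fun z => gkernel a z * F z).
Proof.
move=> mF hF; apply: (@le_integrable _ _ _ _ _ measurableT _
  (EFin \o (fun z => C * (gkernel a z * Q z)))).
- apply/measurable_EFinP; apply: measurable_realfun.measurable_funM => //.
  exact: measurable_gkernel.
- move=> z _ /=; rewrite lee_fin normrM ger0_norm ?gkernel_ge0//.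
  rewrite mulrCA normrM (ger0_norm (gkernel_ge0 _ _)) ler_wpM2l ?gkernel_ge0//.
  exact: le_trans (hF z) (ler_norm _).
- exact: (integrableZl measurableT C (integ_Q a)).
Qed.

Lemma integrable_gkernel a : integ (gkernel a).
Proof.
rewrite (_ : _ \o _ = EFin \o (fun z => gkernel a z * 1)); last first.
  by apply/funext => z /=; rewrite mulr1.
apply: (@integrable_gkernelM a (fun=> 1) 1) => // z; rewrite normr1 mul1r.
exact: Q_ge1.
Qed.

Lemma Rintegral_gkernel a : \int[mu]_z gkernel a z = 1.
Proof. by rewrite /Rintegral integral_gkernel. Qed.

Let coord_le l z : `|c l z| <= Q z.
Proof.
have h : c l z ^+ 2 <= \sum_m c m z ^+ 2.
  by rewrite (bigD1 l)//= lerDl; apply: sumr_ge0 => m _; exact: sqr_ge0.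
apply: (@le_trans _ _ (1 + c l z ^+ 2)); last by rewrite lerD2l.
by rewrite ler_norml; apply/andP; split; nra.
Qed.

Lemma integrable_gkernel_coord a l :
  integ (fun z => gkernel a z * (c l z - a l)).
Proof.
apply: (@integrable_gkernelM a _ (1 + `|a l|)).
  by apply: measurable_realfun.measurable_funB => //; exact: (gc_meas H).
move=> z; apply: le_trans (ler_normB _ _) _.
rewrite -/(Q z) mulrDl mul1r; apply: (lerD (coord_le l z)).
by rewrite ler_peMr//; exact: Q_ge1.
Qed.

Lemma Rintegral_gkernel_coord a l :
  \int[mu]_z (gkernel a z * (c l z - a l)) = 0.
Proof.
have [v [hp hn]] := @integral_gaussian_pos R.
have m1 : measurable_fun [set: measurableTypeR R] (fun t : measurableTypeR R =>
  Num.max t 0 : R).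
  exact: measurable_maxr.
have m2 : measurable_fun [set: measurableTypeR R] (fun t : measurableTypeR R =>
  Num.max (- t) 0 : R).
  by apply: measurable_maxr => //; exact: oppr_measurable.
have max0 (t : R) : 0 <= Num.max t 0 by rewrite le_max lexx orbT.
have e1 := integral_gkernel_coord l m1 (fun t => max0 t) hp.
have e2 := integral_gkernel_coord l m2 (fun t => max0 (- t)) hn.
have i (h : measurableTypeR R -> R) (e :
  (\int[mu]_z (h (c l z) * gkernel (fun=> 0%R) z)%:E = v%:E)%E) :
    measurable_fun setT h -> (forall t, 0 <= h t) ->
    integ (fun z => h (c l z) * gkernel (fun=> 0) z).
  move=> mh h0; apply/integrableP; split.
    apply/measurable_EFinP; apply: measurable_realfun.measurable_funM.
      by apply: (measurableT_comp mh); exact: (gc_meas H).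
    exact: measurable_gkernel.
  under eq_integral do rewrite gee0_abs ?lee_fin ?mulr_ge0 ?gkernel_ge0//.
  by rewrite e ltry.
rewrite /Rintegral -(integral_tr a); last first.
  exact: measurable_int (integrable_gkernel_coord a l).
transitivity (\int[mu]_z (Num.max (c l z) 0 * gkernel (fun=> 0) z -
                          Num.max (- c l z) 0 * gkernel (fun=> 0) z)).
  congr fine; apply: eq_integral => z _; congr (_%:E).
  rewrite -mulrBl mulrC gkernel_tr (gc_trE H) addrK; congr (_ * _).
    by rewrite /Num.max; case: ifP => h1; case: ifP => h2; lra.
  by rewrite (_ : (fun m => a m - a m) = fun=> 0)//; apply/funext => m;
    rewrite subrr.
rewrite RintegralB//; last 2 first.
- exact: (i _ e1 m1 (fun t => max0 t)).
- exact: (i _ e2 m2 (fun t => max0 (- t))).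
by rewrite /Rintegral e1 e2 subrr.
Qed.

End gaussian_mixtures.

(** * The entropy of a mixture under a small contracting move *)

Section entropy_step.
Context d (T : measurableType d) (R : realType).
Context (mu : {measure set T -> \bar R}).
Context (I : finType) (c : I -> T -> R) (tr : (I -> R) -> T -> T).
Hypothesis H : gaussian_coords mu c tr.
Context (k : nat) (p : 'I_k -> R).
Hypotheses (p0 : forall i, 0 <= p i) (p1 : \sum_i p i = 1).
Implicit Types (x y delta : 'I_k -> I -> R) (a : I -> R) (z : T) (F : T -> R).

Local Notation integ F := (mu.-integrable setT (EFin \o F)).
Local Notation gkernel := (gkernel c).
Local Notation mixture := (mixture c p).

Lemma Rintegral_sum (J : finType) (F : J -> T -> R) :
  (forall j, integ (F j)) ->
  \int[mu]_z (\sum_j F j z) = \sum_j \int[mu]_z F j z.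
Proof.
move=> iF; rewrite /Rintegral; under eq_integral do rewrite -sumEFin.
rewrite (integral_sum (f := fun j z => (F j z)%:E) measurableT)//.
by rewrite sum_fine// => j _; exact: (integrable_fin_num measurableT (iF j)).
Qed.

Lemma integrable_Rsum (J : finType) (F : J -> T -> R) :
  (forall j, integ (F j)) -> integ (fun z => \sum_j F j z).
Proof.
move=> iF; rewrite (_ : _ \o _ = fun z => (\sum_j (F j z)%:E)%E).
  by apply: integrable_sum => // j _; exact: iF.
by apply/funext => z /=; rewrite sumEFin.
Qed.

(** The logarithm of a mixture is bounded above by that of the peak of the
kernel, and below by that of a single term of positive weight, which is
quadratic. *)
Lemma ln_mixture_le x : exists C, forall z,
  `|ln (mixture x z)| <= C * (1 + \sum_l c l z ^+ 2).
Proof.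
have [i pi0] := exists_weight_gt0 p0 p1.
set kappa : R := \sum_(l : I) ln (normal_peak (1 : R)).
set X := \sum_l x i l ^+ 2.
have X0 : 0 <= X by apply: sumr_ge0 => l _; exact: sqr_ge0.
exists (`|kappa| + `|ln (p i)| + X + 1) => z.
set S := \sum_l c l z ^+ 2.
have S0 : 0 <= S by apply: sumr_ge0 => l _; exact: sqr_ge0.
have m0 := mixture_gt0 c x z p0 p1.
have up : ln (mixture x z) <= kappa.
  rewrite -[leRHS]expRK ler_ln ?posrE ?expR_gt0//.
  apply: (@le_trans _ _ (\sum_j p j * expR kappa));
    last by rewrite -mulr_suml p1 mul1r.
  apply: ler_sum => j _; apply: ler_wpM2l => //.
  rewrite gkernelE ler_expR gerBl mulr_ge0 ?invr_ge0// sumr_ge0// => l _;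
    exact: sqr_ge0.
have lo : ln (p i) + kappa - (S + X) <= ln (mixture x z).
  have -> : ln (p i) + kappa - (S + X) = ln (p i * expR (kappa - (S + X))).
    by rewrite lnM ?posrE ?expR_gt0// expRK addrA.
  rewrite ler_ln ?posrE ?mulr_gt0 ?expR_gt0//.
  apply: (@le_trans _ _ (p i * gkernel (x i) z)).
    apply: ler_wpM2l => //; rewrite gkernelE ler_expR lerD2l lerN2.
    rewrite -big_split/= mulr_sumr; apply: ler_sum => l _.
    have := sqr_ge0 (c l z + x i l); lra.
  rewrite /mixture (bigD1 i)//= lerDl sumr_ge0// => j _.
  by rewrite mulr_ge0 ?gkernel_ge0.
have A0 := normr_ge0 kappa; have B0 := normr_ge0 (ln (p i)).
have := ler_norm kappa; have := ler_norm (- kappa);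
  have := ler_norm (- ln (p i)).
rewrite !normrN => h1 h2 h3.
have P0 : 0 <= (`|kappa| + `|ln (p i)| + X) * S by rewrite mulr_ge0 ?addr_ge0.
by rewrite ler_norml; apply/andP; split; lra.
Qed.

Lemma measurable_ln_mixture x : measurable_fun setT (fun z => ln (mixture x z)).
Proof. by apply: (measurableT_comp (@measurable_ln R));
  exact: (measurable_mixture H). Qed.

Lemma integrable_gkernel_ln a x :
  integ (fun z => gkernel a z * ln (mixture x z)).
Proof.
have [C hC] := ln_mixture_le x.
by apply: (integrable_gkernelM H) hC; exact: measurable_ln_mixture.
Qed.

Lemma integrable_mixture x : integ (mixture x).
Proof.
apply: integrable_Rsum => i.
exact: (integrableZl measurableT (p i) (integrable_gkernel H (x i))).
Qed.

Lemma Rintegral_mixture x : \int[mu]_z mixture x z = 1.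
Proof.
rewrite Rintegral_sum => [|i].
  under eq_bigr => i _.
    rewrite RintegralZl//; last exact: (integrable_gkernel H).
    rewrite (Rintegral_gkernel H) mulr1.
    over.
  exact: p1.
exact: (integrableZl measurableT (p i) (integrable_gkernel H (x i))).
Qed.

Lemma integrable_mixture_ln x y :
  integ (fun z => mixture x z * ln (mixture y z)).
Proof.
rewrite (_ : (fun z => _) = fun z =>
  \sum_i p i * (gkernel (x i) z * ln (mixture y z))).
  apply: integrable_Rsum => i.
  exact: (integrableZl measurableT (p i) (integrable_gkernel_ln (x i) y)).
by apply/funext => z; rewrite mulr_suml; apply: eq_bigr => i _; rewrite mulrA.
Qed.

(** Gibbs inequality: for the density [mixture x], the expected logarithm of a
density [mixture y] is largest when [y] is [x]. *)
Lemma gibbs x y :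
  \int[mu]_z (mixture x z * ln (mixture y z)) <= neg_entropy mu (mixture x).
Proof.
(* This is [ln t <= t - 1] at [t = v / u], multiplied by [u]. *)
have h : \int[mu]_z (mixture x z * ln (mixture y z) + mixture x z) <=
         \int[mu]_z (mixture x z * ln (mixture x z) + mixture y z).
  apply: le_Rintegral => //.
  - by apply: (@integrableD _ _ _ mu setT measurableT (fun z =>
      (mixture x z * ln (mixture y z))%:E)
      (fun z => (mixture x z)%:E));
      [exact: integrable_mixture_ln|exact: integrable_mixture].
  - by apply: (@integrableD _ _ _ mu setT measurableT (fun z =>
      (mixture x z * ln (mixture x z))%:E)
      (fun z => (mixture y z)%:E));
      [exact: integrable_mixture_ln|exact: integrable_mixture].
  move=> z _; have x0 := mixture_gt0 c x z p0 p1;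
    have y0 := mixture_gt0 c y z p0 p1.
  set u := mixture x z in x0 *; set v := mixture y z in y0 *.
  have := expR_ge1Dx (ln v - ln u).
  have -> : expR (ln v - ln u) = v / u by rewrite expRD expRN !lnK.
  by rewrite ler_pdivlMr//; lra.
rewrite !RintegralD ?Rintegral_mixture// in h; first by rewrite lerD2r in h.
all: by [exact: integrable_mixture_ln|exact: integrable_mixture].
Qed.

Lemma gkernel_shift a b z : gkernel a (tr b z) =
  gkernel a z * expR (\sum_l (a l - c l z) * b l - 2^-1 * \sum_l b l ^+ 2).
Proof.
rewrite !gkernelE -expRD; congr expR; rewrite -!addrA; congr (_ + _).
rewrite !mulr_sumr -!sumrN -!big_split/=; apply: eq_bigr => l _.
by rewrite (gc_trE H); field.
Qed.

(** If the points [x] move by [delta] without any two of them moving apart to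
first order, the entropy increases by at most a term of second order in
[delta]. *)
Lemma neg_entropy_step x delta :
  (forall i j, \sum_l (x i l - x j l) * (delta i l - delta j l) <= 0) ->
  neg_entropy mu (mixture x) - 2^-1 * \sum_i p i * \sum_l delta i l ^+ 2 <=
  neg_entropy mu (mixture (fun i l => x i l + delta i l)).
Proof.
move=> hd; set y := fun i l => x i l + delta i l.
apply: le_trans (gibbs y x).
pose e z i j : R :=
  \sum_l (x j l - c l z) * delta i l - 2^-1 * \sum_l delta i l ^+ 2.
have yE i : (fun l => y i l - delta i l) = x i.
  by apply/funext => l; rewrite /y addrK.
(* The [i]-th term of the integral of [mixture y * ln (mixture x)], translated
   so that its kernel is centred at [x i]. *)
pose L i z : R := gkernel (x i) z * ln (mixture x (tr (delta i) z)).
have iL i : integ (L i).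
  have [C hC] := ln_mixture_le x.
  have mL : measurable_fun setT (fun z => gkernel (y i) z * ln (mixture x z)).
    apply: measurable_realfun.measurable_funM;
      first exact: (measurable_gkernel H).
    exact: measurable_ln_mixture.
  have E : L i = fun z =>
    gkernel (y i) (tr (delta i) z) * ln (mixture x (tr (delta i) z)).
    by apply/funext => z; rewrite /L (gkernel_tr H) yE.
  have /integrableP[_ hfin] := integrable_gkernel_ln (y i) x.
  apply/integrableP; split.
    by rewrite E; apply/measurable_EFinP; apply: (measurableT_comp mL);
      exact: (gc_trm H).
  rewrite E /= (integral_tr H (delta i) (F := fun z =>
    `|gkernel (y i) z * ln (mixture x z)|%:E))//.
  by apply/measurable_EFinP; exact: measurableT_comp.
have EL i : \int[mu]_z L i z = \int[mu]_z (gkernel (y i) z * ln (mixture x z)).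
  rewrite /Rintegral -[in RHS](integral_tr H (delta i)
    (F := fun z => (gkernel (y i) z * ln (mixture x z))%:E)); last first.
    by have /integrableP[] := integrable_gkernel_ln (y i) x.
  by congr fine; apply: eq_integral => z _; rewrite /L (gkernel_tr H) yE.
have iq i (r : R) l : integ (fun z => gkernel (x i) z * (x i l - c l z) * r).
  rewrite (_ : _ \o _ = fun z =>
    ((- r)%:E * (gkernel (x i) z * (c l z - x i l))%:E)%E).
    exact: (integrableZl measurableT _ (integrable_gkernel_coord H (x i) l)).
  by apply/funext => z /=; rewrite -EFinM; congr (_%:E); ring.
(* The diagonal exponent against the kernel centred at [x i]: the linear part
   has mean zero, so that the integral of [q i] is [- |delta i|^2 / 2]. *)
pose q i z : R := gkernel (x i) z * e z i i.
have qE i : q i = fun z =>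
  \sum_l gkernel (x i) z * (x i l - c l z) * delta i l -
      gkernel (x i) z * (2^-1 * \sum_l delta i l ^+ 2).
  apply/funext => z; rewrite /q /e mulrBr mulr_sumr; congr (_ - _).
  by apply: eq_bigr => l _; rewrite mulrA.
have ig i C : integ (fun z => gkernel (x i) z * C).
  rewrite (_ : _ \o _ = fun z => (C%:E * (gkernel (x i) z)%:E)%E).
    exact: (integrableZl measurableT _ (integrable_gkernel H (x i))).
  by apply/funext => z /=; rewrite -EFinM mulrC.
have iqs i : integ (q i).
  rewrite qE; apply: (@integrableB _ _ _ mu setT measurableT
    (fun z => (\sum_l gkernel (x i) z * (x i l - c l z) * delta i l)%:E)
    (fun z => (gkernel (x i) z * (2^-1 * \sum_l delta i l ^+ 2))%:E)).
    by apply: integrable_Rsum => l; exact: iq.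
  exact: ig.
have Eq i : \int[mu]_z q i z = - (2^-1 * \sum_l delta i l ^+ 2).
  rewrite qE RintegralB//; last by apply: integrable_Rsum => l; exact: iq.
  rewrite Rintegral_sum => [|l]; last exact: iq.
  rewrite big1 ?sub0r => [|l _].
    by rewrite RintegralZr ?(Rintegral_gkernel H) ?mul1r//;
      exact: (integrable_gkernel H).
  under eq_Rintegral => z _.
    rewrite (_ : _ * _ = - delta i l * (gkernel (x i) z * (c l z - x i l)));
      last by ring.
    over.
  rewrite RintegralZl//; last exact: (integrable_gkernel_coord H).
  by rewrite (Rintegral_gkernel_coord H) mulr0.
have ipq i : integ (fun z => p i * q i z) by exact:
  (integrableZl measurableT _ (iqs i)).
have ipL i : integ (fun z => p i * L i z) by exact:
  (integrableZl measurableT _ (iL i)).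
have lhsE :
    neg_entropy mu (mixture x) - 2^-1 * \sum_i p i * \sum_l delta i l ^+ 2 =
    \int[mu]_z (mixture x z * ln (mixture x z) + \sum_i p i * q i z).
  rewrite RintegralD//; [|exact: integrable_mixture_ln|exact: integrable_Rsum].
  congr (_ + _); rewrite Rintegral_sum// mulr_sumr -sumrN;
    apply: eq_bigr => i _.
  rewrite RintegralZl// Eq; ring.
have rhsE : \int[mu]_z (mixture y z * ln (mixture x z)) =
  \int[mu]_z (\sum_i p i * L i z).
  rewrite Rintegral_sum//.
  under [RHS]eq_bigr => i _.
    rewrite RintegralZl// EL -RintegralZl//; last exact: integrable_gkernel_ln.
    over.
  rewrite -Rintegral_sum => [|i].
    by apply: eq_Rintegral => z _; rewrite mulr_suml; apply: eq_bigr => i _;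
      rewrite mulrA.
  exact: (integrableZl measurableT _ (integrable_gkernel_ln _ _)).
rewrite lhsE rhsE; apply: le_Rintegral => //; last 2 first.
- exact: integrable_Rsum.
- move=> z _.
  have -> : \sum_i p i * q i z = \sum_i (p i * gkernel (x i) z) * e z i i.
    by apply: eq_bigr => i _; rewrite mulrA.
  have -> : \sum_i p i * L i z = \sum_i (p i * gkernel (x i) z) *
      ln (\sum_j (p j * gkernel (x j) z) * expR (e z i j)).
    apply: eq_bigr => i _; rewrite /L mulrA; congr (_ * ln _).
    by apply: eq_bigr => j _; rewrite gkernel_shift mulrA.
  apply: sum_ln_sum_expR_ge.
  - by move=> i; rewrite mulr_ge0 ?gkernel_ge0.
  - exact: mixture_gt0.
  - move=> i j; rewrite -subr_le0; apply: le_trans (hd i j).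
    rewrite le_eqVlt; apply/orP; left; apply/eqP; rewrite /e.
    rewrite !mulr_sumr -!sumrN -!big_split/= -sumrN -big_split/=.
    by apply: eq_bigr => l _; ring.
- apply: (@integrableD _ _ _ mu setT measurableT (fun z =>
    (mixture x z * ln (mixture x z))%:E)
    (fun z => (\sum_i p i * q i z)%:E)); first exact: integrable_mixture_ln.
  exact: integrable_Rsum.
Qed.

End entropy_step.

(** * Coordinates on products and on tuples *)

Section product_coords.
Context d1 (T1 : measurableType d1) d2 (T2 : measurableType d2) (R : realType).
Context (mu1 : {sigma_finite_measure set T1 -> \bar R}).
Context (mu2 : {sigma_finite_measure set T2 -> \bar R}).
Context (I1 I2 : finType).
Context (c1 : I1 -> T1 -> R) (tr1 : (I1 -> R) -> T1 -> T1).
Context (c2 : I2 -> T2 -> R) (tr2 : (I2 -> R) -> T2 -> T2).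

(** The coordinates of a pair are those of its two components. *)
Definition pair_coord (s : I1 + I2) (z : T1 * T2) : R :=
  match s with inl l => c1 l z.1 | inr l => c2 l z.2 end.

(** The translation of both components. *)
Definition pair_tr (a : I1 + I2 -> R) (z : T1 * T2) : T1 * T2 :=
  (tr1 (fun l => a (inl l)) z.1, tr2 (fun l => a (inr l)) z.2).

Lemma gaussian_coords_pair :
  gaussian_coords mu1 c1 tr1 -> gaussian_coords mu2 c2 tr2 ->
  gaussian_coords (mu1 \x mu2)%E pair_coord pair_tr.
Proof.
move=> H1 H2.
have mtr a : measurable_fun setT (pair_tr a).
  apply: measurable_fun_pair.
    by apply: (measurableT_comp (gc_trm H1 _)); exact: measurable_fst.
  by apply: (measurableT_comp (gc_trm H2 _)); exact: measurable_snd.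
split => //.
- move=> [l|l].
    by apply: (measurableT_comp (gc_meas H1 l)); exact: measurable_fst.
  by apply: (measurableT_comp (gc_meas H2 l)); exact: measurable_snd.
- by move=> a [l|l] z /=; [rewrite (gc_trE H1)|rewrite (gc_trE H2)].
- move=> a F mF F0.
  rewrite (fubini_tonelli1 (fun z => F (pair_tr a z)))//;
    last exact: measurableT_comp.
  rewrite fubini_tonelli1//.
  transitivity (\int[mu1]_x fubini_F mu2 F (tr1 (fun l => a (inl l)) x))%E.
    apply: eq_integral => x _; rewrite /fubini_F /pair_tr /=.
    apply: (gc_inv H2 _ (F := fun y =>
      F (tr1 (fun l => a (inl l)) x, y))) => //.
    exact: (measurableT_comp mF (measurable_pair1 _)).
  apply: (gc_inv H1) => //; first exact: measurable_fun_fubini_tonelli_F.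
  by move=> x; exact: integral_ge0.
- move=> h v mh h0 hv.
  have v0 l : 0 <= v l by rewrite -lee_fin -hv; apply: integral_ge0 => t _;
    rewrite lee_fin.
  pose f1 x := \prod_(l : I1) h (inl l) (c1 l x).
  pose f2 y := \prod_(l : I2) h (inr l) (c2 l y).
  have mf1 : measurable_fun setT f1.
    by apply: measurable_prod => l _;
      exact: (measurableT_comp (mh _) (gc_meas H1 l)).
  have mf2 : measurable_fun setT f2.
    by apply: measurable_prod => l _;
      exact: (measurableT_comp (mh _) (gc_meas H2 l)).
  have f10 x : 0 <= f1 x by exact: prodr_ge0.
  have f20 y : 0 <= f2 y by exact: prodr_ge0.
  under eq_integral => z _ do rewrite big_sumType/= -/(f1 z.1) -/(f2 z.2).
  rewrite fubini_tonelli1/=; first last.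
  - by move=> z; rewrite lee_fin mulr_ge0.
  - apply/measurable_EFinP; apply: measurable_realfun.measurable_funM.
      by apply: (measurableT_comp mf1); exact: measurable_fst.
    by apply: (measurableT_comp mf2); exact: measurable_snd.
  rewrite /fubini_F /=.
  have e1 := gc_prod H1 (fun l => mh (inl l)) (fun l => h0 (inl l)) (fun l =>
    hv (inl l)).
  have e2 := gc_prod H2 (fun l => mh (inr l)) (fun l => h0 (inr l)) (fun l =>
    hv (inr l)).
  under eq_integral => x _.
    under eq_integral do rewrite EFinM.
    rewrite ge0_integralZl//; last 3 first.
    - exact/measurable_EFinP.
    - by move=> y _; rewrite lee_fin.
    - by rewrite lee_fin.
    rewrite e2 muleC.
    over.
  rewrite ge0_integralZl//; last 3 first.
  - exact/measurable_EFinP.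
  - by move=> y _; rewrite lee_fin.
  - by rewrite lee_fin prodr_ge0.
  by rewrite e1 -EFinM mulrC big_sumType.
Qed.

End product_coords.

Section tuple_coords.
Context (R : realType).

(** The translation of [n.-tuple R] by the vector with coordinates [a]. *)
Definition tshift n (a : 'I_n -> R) (t : n.-tuple R) : n.-tuple R :=
  [tuple tnth t i + a i | i < n].

Lemma measurable_tshift n (a : 'I_n -> R) : measurable_fun setT (tshift a).
Proof.
apply/measurable_fun_tnthP => i.
rewrite (_ : _ \o _ = fun t => tnth t i + a i).
  by apply: measurable_realfun.measurable_funD => //; exact: measurable_tnth.
by apply/funext => t /=; rewrite tnth_mktuple.
Qed.

Lemma tshift_tcons n (a : 'I_n.+1 -> R) s (t : n.-tuple R) :
  tshift a (tcons (s, t)) =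
    tcons (s + a ord0, tshift (fun i => a (lift ord0 i)) t).
Proof.
apply: eq_from_tnth => i; rewrite tnth_mktuple.
case: (unliftP ord0 i) => [j ->|->].
  by rewrite /tcons !tnthS tnth_mktuple.
by rewrite /tcons !tnth0.
Qed.

(** Tonelli for the recursive definition of Lebesgue measure on tuples. *)
Lemma ge0_integral_tcons n (F : n.+1.-tuple R -> \bar R) :
  measurable_fun setT F -> (forall t, 0 <= F t)%E ->
  (\int[lebesgue_tuple R n.+1]_t F t =
   \int[@lebesgue_measure R]_s \int[lebesgue_tuple R n]_t F (tcons (s, t)))%E.
Proof.
move=> mF F0; rewrite /= /cons_measure.
rewrite (ge0_integral_pushforward (@measurable_tcons R n))//.
rewrite preimage_setT fubini_tonelli1//.
  by apply: measurableT_comp => //; exact: measurable_tcons.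
by move=> x; exact: F0.
Qed.

Lemma gaussian_coords_tuple n : gaussian_coords (lebesgue_tuple R n)
  (fun i t => tnth t i) (@tshift n).
Proof.
elim: n => [|n IH].
  split.
  - by move=> l; exact: measurable_tnth.
  - by move=> a; exact: measurable_tshift.
  - by move=> a l z; rewrite tnth_mktuple.
  - by move=> a F mF F0; apply: eq_integral => z _;
      rewrite [tshift _ _]tuple0 [in RHS](tuple0 z).
  - move=> h v _ _ _; rewrite big_ord0.
    under eq_integral do rewrite big_ord0.
    by rewrite integral_cst//= mul1e diracT.
split.
- by move=> l; exact: measurable_tnth.
- by move=> a; exact: measurable_tshift.
- by move=> a l z; rewrite tnth_mktuple.
- move=> a F mF F0.
  have mFt : measurable_fun setT (F \o @tcons R n).
    by apply: measurableT_comp => //; exact: measurable_tcons.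
  rewrite (ge0_integral_tcons (F := fun z => F (tshift a z)))//; last first.
    by apply: measurableT_comp => //; exact: measurable_tshift.
  rewrite ge0_integral_tcons//.
  pose G (s : measurableTypeR R) :=
    (\int[lebesgue_tuple R n]_t F (tcons (s, t)))%E.
  transitivity (\int[@lebesgue_measure R]_s G (s + a ord0)%R)%E.
    apply: eq_integral => s _; rewrite /G.
    under eq_integral do rewrite tshift_tcons.
    apply: (gc_inv IH _ (F := fun t => F (tcons ((s + a ord0)%R, t)))) => //.
    exact: (measurableT_comp mFt (measurable_pair1 _)).
  apply: ge0_integral_lebesgue_shift.
    apply: (measurable_fun_fubini_tonelli_F _ mFt) => z; exact: F0.
  by move=> s; exact: integral_ge0.
- move=> h v mh h0 hv.
  have v0 l : 0 <= v l by rewrite -lee_fin -hv; apply: integral_ge0 => t _;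
    rewrite lee_fin.
  pose f2 (t : n.-tuple R) := \prod_(l < n) h (lift ord0 l) (tnth t l).
  have mf2 : measurable_fun setT f2.
    by apply: measurable_prod => l _;
      exact: (measurableT_comp (mh _) (gc_meas IH l)).
  have f20 y : 0 <= f2 y by exact: prodr_ge0.
  rewrite ge0_integral_tcons; first last.
  - by move=> t; rewrite lee_fin; exact: prodr_ge0.
  - apply/measurable_EFinP; apply: measurable_prod => l _.
    exact: (measurableT_comp (mh _) (measurable_tnth l)).
  have e2 := gc_prod IH (fun l => mh (lift ord0 l)) (fun l =>
    h0 (lift ord0 l)) (fun l => hv (lift ord0 l)).
  rewrite big_ord_recl EFinM -hv.
  under eq_integral => s _.
    under eq_integral => t _.
      rewrite big_ord_recl/= {1}/tcons tnth0.
      under eq_bigr => l _ do rewrite {1}/tcons tnthS.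
      rewrite -/(f2 t) EFinM.
      over.
    rewrite /= ge0_integralZl//; last 3 first.
    - exact/measurable_EFinP.
    - by move=> y _; rewrite lee_fin.
    - by rewrite lee_fin.
    rewrite e2 muleC.
    over.
  rewrite ge0_integralZl//; last 3 first.
  - exact/measurable_EFinP.
  - by move=> y _; rewrite lee_fin.
  - by rewrite lee_fin prodr_ge0.
  by rewrite muleC.
Qed.

End tuple_coords.

(** * Contraction of the points decreases the entropy *)

Section product_integrals.
Context d1 (T1 : measurableType d1) d2 (T2 : measurableType d2) (R : realType).
Context (mu1 : {sigma_finite_measure set T1 -> \bar R}).
Context (mu2 : {sigma_finite_measure set T2 -> \bar R}).
Context (F : T1 -> R) (G : T2 -> R).
Hypotheses (iF : mu1.-integrable setT (EFin \o F)).
Hypotheses (iG : mu2.-integrable setT (EFin \o G)).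

Let mFG : measurable_fun setT (fun z : T1 * T2 => (F z.1 * G z.2)%:E).
Proof.
apply/measurable_EFinP; apply: measurable_realfun.measurable_funM.
- have /measurable_EFinP mF : measurable_fun setT (EFin \o F)
    by have /integrableP[] := iF.
  by apply: (measurableT_comp mF); exact: measurable_fst.
- have /measurable_EFinP mG : measurable_fun setT (EFin \o G)
    by have /integrableP[] := iG.
  by apply: (measurableT_comp mG); exact: measurable_snd.
Qed.

Lemma integrable_tensor :
  (mu1 \x mu2)%E.-integrable setT (EFin \o (fun z : T1 * T2 => F z.1 * G z.2)).
Proof.
have /integrableP[mF F1] := iF; have /integrableP[mG G1] := iG.
apply/(integrable12ltyP mu1 mu2 mFG) => /=.
rewrite (_ : (\int[mu1]_x _)%E =
  (\int[mu1]_x ((\int[mu2]_y `|(EFin \o G) y|) * `|(EFin \o F) x|))%E).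
  rewrite ge0_integralZl//.
  - by rewrite lte_mul_pinfty//;
      [exact: integral_ge0|rewrite ge0_fin_numE// ; exact: integral_ge0].
  - exact: measurableT_comp.
  - exact: integral_ge0.
apply: eq_integral => x _.
under eq_integral do rewrite normrM EFinM.
have mG' : measurable_fun setT (fun y => `|G y|%:E).
  by apply/measurable_EFinP; apply: measurableT_comp => //;
    exact/measurable_EFinP.
by rewrite (ge0_integralZl mu2 measurableT mG')// muleC.
Qed.

Lemma Rintegral_tensor : \int[(mu1 \x mu2)%E]_z (F z.1 * G z.2) =
  (\int[mu1]_x F x) * (\int[mu2]_y G y).
Proof.
rewrite {1}/Rintegral -(integral12_prod_meas1 integrable_tensor).
rewrite /fubini_F/= -RintegralZr//; congr fine; apply: eq_integral => x _.
under eq_integral do rewrite EFinM.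
by rewrite integralZl// EFinM fineK//; exact: integrable_fin_num.
Qed.

End product_integrals.

Section entropy_contraction.
Context d (T : measurableType d) (R : realType).
Context (mu : {sigma_finite_measure set T -> \bar R}).
Context (I : finType) (c : I -> T -> R) (tr : (I -> R) -> T -> T).
Hypothesis H : gaussian_coords mu c tr.
Context (k : nat) (p : 'I_k -> R).
Hypotheses (p0 : forall i, 0 <= p i) (p1 : \sum_i p i = 1).
Context (x y : 'I_k -> I -> R).
Hypothesis hxy : forall i j,
  \sum_l (y i l - y j l) ^+ 2 <= \sum_l (x i l - x j l) ^+ 2.

Local Notation mu2 := (mu \x mu)%E.
Local Notation c2 := (pair_coord c c).

(** The points [(a x i, b y i)] of the doubled space. *)
Definition scaled_pair (a b : R) (i : 'I_k) (s : I + I) : R :=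
  match s with inl l => a * x i l | inr l => b * y i l end.

Let E a b : R := neg_entropy mu2 (mixture c2 p (scaled_pair a b)).
(* The second moment of the points, which controls the length of every step. *)
Let M : R := \sum_i p i * (\sum_l x i l ^+ 2 + \sum_l y i l ^+ 2).

Let M_ge0 : 0 <= M.
Proof.
by apply: sumr_ge0 => i _; rewrite mulr_ge0// addr_ge0// sumr_ge0// => l _;
  exact: sqr_ge0.
Qed.

(* One step along the unit circle.  The inner product that must be nonpositive
   is [a (a' - a) |x i - x j|^2 + b (b' - b) |y i - y j|^2]: as [a' <= a] and
   [|y i - y j| <= |x i - x j|], it is at most
   [(a a' + b b' - 1) |y i - y j|^2]. *)
Let E_step a b a' b' : 0 <= a' <= a -> a ^+ 2 + b ^+ 2 = 1 ->
  a' ^+ 2 + b' ^+ 2 = 1 ->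
  E a b - 2^-1 * (((a' - a) ^+ 2 + (b' - b) ^+ 2) * M) <= E a' b'.
Proof.
move=> /andP[a'0 a'a] ab ab'.
pose delta i s := scaled_pair a' b' i s - scaled_pair a b i s.
have hd i j : \sum_s (scaled_pair a b i s - scaled_pair a b j s) *
    (delta i s - delta j s) <= 0.
  pose Dx := \sum_l (x i l - x j l) ^+ 2;
    pose Dy := \sum_l (y i l - y j l) ^+ 2.
  have -> : \sum_s (scaled_pair a b i s - scaled_pair a b j s) *
    (delta i s - delta j s) = a * (a' - a) * Dx + b * (b' - b) * Dy.
    rewrite big_sumType/= !mulr_sumr; congr (_ + _); apply: eq_bigr => l _;
    by rewrite /delta/=; ring.
  have hD : 0 <= Dx - Dy by rewrite subr_ge0; exact: hxy.
  have Dy0 : 0 <= Dy by apply: sumr_ge0 => l _; exact: sqr_ge0.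
  have h1 : 0 <= (a * (a - a')) * (Dx - Dy).
    by rewrite !mulr_ge0// ?subr_ge0//; exact: le_trans a'a.
  have h2 : 0 <= (1 - (a * a' + b * b')) * Dy.
    by rewrite mulr_ge0//; have := sqr_ge0 (a - a'); have := sqr_ge0 (b - b');
      nra.
  have -> : a * (a' - a) * Dx + b * (b' - b) * Dy =
    - (a * (a - a') * (Dx - Dy)) - (1 - (a * a' + b * b')) * Dy by rewrite -ab;
        ring.
  lra.
have := neg_entropy_step (gaussian_coords_pair H H) p0 p1 hd.
rewrite (_ : (fun i l => scaled_pair a b i l + delta i l) = scaled_pair a' b');
  last first.
  by apply/funext => i; apply/funext => s; rewrite /delta addrC subrK.
apply: le_trans; rewrite lerD2l lerN2 ler_wpM2l ?invr_ge0//.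
rewrite /M mulr_sumr; apply: ler_sum => i _; rewrite mulrCA;
  apply: ler_wpM2l => //.
rewrite big_sumType/=.
have -> : \sum_l delta i (inl l) ^+ 2 = (a' - a) ^+ 2 * \sum_l x i l ^+ 2.
  by rewrite mulr_sumr; apply: eq_bigr => l _; rewrite /delta/=; ring.
have -> : \sum_l delta i (inr l) ^+ 2 = (b' - b) ^+ 2 * \sum_l y i l ^+ 2.
  by rewrite mulr_sumr; apply: eq_bigr => l _; rewrite /delta/=; ring.
have X0 : 0 <= \sum_l x i l ^+ 2 by apply: sumr_ge0 => l _; exact: sqr_ge0.
have Y0 : 0 <= \sum_l y i l ^+ 2 by apply: sumr_ge0 => l _; exact: sqr_ge0.
have := mulr_ge0 (sqr_ge0 (a' - a)) Y0; have := mulr_ge0 (sqr_ge0 (b' - b)) X0;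
  lra.
Qed.

(* The rational parametrization of the quarter circle from [(1, 0)], at [s = 0],
   to [(0, 1)], at [s = 1]; the chord between the parameters [s] and [t] has
   length at most [2 |t - s|]. *)
Let A (s : R) : R := (1 - s ^+ 2) / (1 + s ^+ 2).
Let B (s : R) : R := (2 * s) / (1 + s ^+ 2).

Let E_arc s t : 0 <= s -> s <= t -> t <= 1 ->
  E (A s) (B s) - 2 * (t - s) ^+ 2 * M <= E (A t) (B t).
Proof.
move=> s0 st t1.
have S0 : 0 < 1 + s ^+ 2 by rewrite ltr_pwDl// sqr_ge0.
have T0 : 0 < 1 + t ^+ 2 by rewrite ltr_pwDl// sqr_ge0.
have AB r : 0 < 1 + r ^+ 2 -> A r ^+ 2 + B r ^+ 2 = 1.
  by move=> r0; rewrite /A /B; field; rewrite gt_eqF.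
apply: le_trans (@E_step (A s) (B s) (A t) (B t) _ (AB _ S0) (AB _ T0));
  last first.
  apply/andP; split.
    by rewrite divr_ge0 ?(ltW T0)// subr_ge0 expr_le1// (le_trans s0).
  by rewrite /A ler_pdivrMr// mulrAC ler_pdivlMr//; nra.
rewrite lerD2l lerN2 mulrA; apply: ler_wpM2r => //.
have -> : (A t - A s) ^+ 2 + (B t - B s) ^+ 2 =
    4 * ((t - s) ^+ 2 / ((1 + s ^+ 2) * (1 + t ^+ 2))).
  by rewrite /A /B; field; rewrite !gt_eqF.
have : (t - s) ^+ 2 / ((1 + s ^+ 2) * (1 + t ^+ 2)) <= (t - s) ^+ 2; last first.
  by set u := (t - s) ^+ 2 / _; set v := (t - s) ^+ 2; clearbody u v; lra.
rewrite ler_pdivrMr ?mulr_gt0// ler_peMr ?sqr_ge0//.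
by have := sqr_ge0 s; have := sqr_ge0 t; nra.
Qed.

(* The first [m] of the [N.+1] steps of parameter length [1 / N.+1]. *)
Let E_path (N m : nat) : (m <= N.+1)%N ->
  E 1 0 - 2 * (m%:R / N.+1%:R ^+ 2) * M <=
  E (A (m%:R / N.+1%:R)) (B (m%:R / N.+1%:R)).
Proof.
have N0 : 0 < N.+1%:R :> R by rewrite ltr0n.
elim: m => [_|m IH mN].
  rewrite !mul0r mulr0 mul0r subr0 /A /B expr0n/=
    !addr0 subr0 divr1 mulr0 mul0r.
  exact: lexx.
have := @E_arc (m%:R / N.+1%:R) (m.+1%:R / N.+1%:R).
have -> : m.+1%:R / N.+1%:R - m%:R / N.+1%:R = N.+1%:R^-1 :> R.
  by rewrite -mulrBl -natrB// subSnn mul1r.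
rewrite divr_ge0 ?ler0n// ler_pdivlMr// mulfVK ?gt_eqF// ler_nat leqnSn.
rewrite ler_pdivrMr// mul1r ler_nat => /(_ isT isT mN).
apply: le_trans.
have e (u v q r : R) : u - 2 * q * M <= v ->
  u - 2 * (q + r) * M <= v - 2 * r * M.
  by move=> h; lra.
have -> : m.+1%:R / N.+1%:R ^+ 2 = m%:R / N.+1%:R ^+ 2 + N.+1%:R^-1 ^+ 2 :> R.
  by rewrite -[in LHS]addn1 natrD mulrDl mul1r exprVn.
exact: e (IH (ltnW mN)).
Qed.

Let E_endpoints : E 1 0 <= E 0 1.
Proof.
have contra (u v w : R) : w < u - v -> u - w <= v -> False by move=> *; lra.
rewrite leNgt; apply/negP => h.
have e0 : 0 < E 1 0 - E 0 1 by rewrite subr_gt0.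
set e := E 1 0 - E 0 1 in e0.
pose N := Num.Def.archi_bound (2 * M / e).
have hN : 2 * M / e < N.+1%:R.
  apply: lt_trans (_ : N%:R < _); last by rewrite ltr_nat.
  by apply: archi_boundP; rewrite divr_ge0 ?mulr_ge0// ltW.
have N0 : 0 < N.+1%:R :> R by rewrite ltr0n.
have := @E_path N N.+1 (leqnn _).
rewrite divff ?gt_eqF//.
have -> : A 1 = 0 by rewrite /A expr1n subrr mul0r.
have -> : B 1 = 1 by rewrite /B expr1n mulr1 divff.
have -> : N.+1%:R / N.+1%:R ^+ 2 = N.+1%:R^-1 :> R by field; rewrite gt_eqF.
rewrite ltr_pdivrMr// in hN.
have : 2 * N.+1%:R^-1 * M < e.
  by rewrite mulrAC ltr_pdivrMr// [ltRHS]mulrC.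
exact: contra.
Qed.

Let mixture_cst a z : mixture c p (fun=> a) z = gkernel c a z.
Proof. by rewrite /mixture -mulr_suml p1 mul1r. Qed.

(* The contribution of the component in which all points are at the origin, the
   same at both ends of the path. *)
Let G0 : R := neg_entropy mu (gkernel c (fun=> 0)).

Let int_ent z :
  mu.-integrable setT (EFin \o (fun t =>
  mixture c p z t * ln (mixture c p z t))).
Proof. exact: (integrable_mixture_ln H p0 p1). Qed.

Let int_entG : mu.-integrable setT
  (EFin \o (fun t => gkernel c (fun=> 0) t * ln (gkernel c (fun=> 0) t))).
Proof.
rewrite (_ : (fun t => _) = (fun t =>
  mixture c p (fun _ _ => 0) t * ln (mixture c p (fun _ _ => 0) t))).
  exact: int_ent.
by apply/funext => t; rewrite mixture_cst.
Qed.

Let neg_entropy_tensor (f g : T -> R) : (forall t, 0 < f t) ->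
  (forall t, 0 < g t) ->
  mu.-integrable setT (EFin \o f) -> mu.-integrable setT (EFin \o g) ->
  \int[mu]_t f t = 1 -> \int[mu]_t g t = 1 ->
  mu.-integrable setT (EFin \o (fun t => f t * ln (f t))) ->
  mu.-integrable setT (EFin \o (fun t => g t * ln (g t))) ->
  neg_entropy mu2 (fun z => f z.1 * g z.2) = neg_entropy mu f +
    neg_entropy mu g.
Proof.
move=> f0 g0 jf jg f1 g1 jlf jlg; rewrite /neg_entropy.
transitivity (\int[mu2]_z (f z.1 * ln (f z.1) * g z.2 + f z.1 *
  (g z.2 * ln (g z.2)))).
  by apply: eq_Rintegral => z _; rewrite lnM ?posrE//; ring.
rewrite RintegralD//.
- by rewrite (Rintegral_tensor jlf jg) (Rintegral_tensor jf jlg) f1 g1 mulr1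
    mul1r.
- exact: (integrable_tensor jlf jg).
- exact: (integrable_tensor jf jlg).
Qed.

Let E10 : E 1 0 = neg_entropy mu (mixture c p x) + G0.
Proof.
rewrite -neg_entropy_tensor//.
- rewrite /E; congr neg_entropy; apply/funext => z.
  rewrite /mixture mulr_suml; apply: eq_bigr => i _; rewrite -mulrA;
    congr (_ * _).
  rewrite /gkernel big_sumType/=; congr (_ * _); apply: eq_bigr => l _;
    congr normal_pdf.
    by rewrite mul1r.
  by rewrite mul0r.
- by move=> t; exact: mixture_gt0.
- by move=> t; exact: gkernel_gt0.
- exact: (integrable_mixture H p).
- exact: (integrable_gkernel H).
- exact: (Rintegral_mixture H p1).
- exact: (Rintegral_gkernel H).
Qed.

Let E01 : E 0 1 = G0 + neg_entropy mu (mixture c p y).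
Proof.
rewrite -neg_entropy_tensor//.
- rewrite /E; congr neg_entropy; apply/funext => z.
  rewrite /mixture mulr_sumr; apply: eq_bigr => i _; rewrite mulrCA;
    congr (_ * _).
  rewrite /gkernel big_sumType/=; congr (_ * _); apply: eq_bigr => l _;
    congr normal_pdf.
    by rewrite mul0r.
  by rewrite mul1r.
- by move=> t; exact: gkernel_gt0.
- by move=> t; exact: mixture_gt0.
- exact: (integrable_gkernel H).
- exact: (integrable_mixture H p).
- exact: (Rintegral_gkernel H).
- exact: (Rintegral_mixture H p1).
Qed.

Lemma neg_entropy_mixture_contraction :
  neg_entropy mu (mixture c p x) <= neg_entropy mu (mixture c p y).
Proof.
by have := E_endpoints; rewrite E10 E01 addrC lerD2l.
Qed.

End entropy_contraction.

(** * The entropy of the output of the channel *)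

(** The input is presented as [x (J w)] with a random label [J] independent of
the noise [Z]; the points [x i] need not be distinct. *)
Section entropy_of_mixture.
Context d (T : measurableType d) (R : realType) (n k : nat) (P :
  probability T R).
Context (W Z : {RV P >-> n.-tuple R}) (x : 'I_k -> n.-tuple R) (J : T -> 'I_k).
Hypothesis WE : forall w, W w = vadd (x (J w)) (Z w).
Hypothesis gZ : standard_gaussian Z.
Hypothesis mJ : forall i, measurable (J @^-1` [set i]).
Hypothesis indepJ : forall i B, measurable B ->
  P (J @^-1` [set i] `&` Z @^-1` B) = (P (J @^-1` [set i]) * P (Z @^-1` B))%E.

Local Notation mu := (lebesgue_tuple R n).
Local Notation coord := (fun (i : 'I_n) (t : n.-tuple R) => tnth t i).

(** The probability of the label [i]. *)
Definition label_prob (i : 'I_k) : R := fine (P (J @^-1` [set i])).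

Local Notation f := (mixture coord label_prob (fun i l => tnth (x i) l)).

Lemma label_prob_ge0 i : 0 <= label_prob i.
Proof. by rewrite fine_ge0. Qed.

Lemma label_probE i : (label_prob i)%:E = P (J @^-1` [set i]).
Proof. by rewrite fineK// fin_num_measure. Qed.

Lemma prob_labels (A : set T) : measurable A ->
  P A = (\sum_i P (J @^-1` [set i] `&` A))%E.
Proof.
move=> mA; rewrite -measure_bigsetU_ord//.
- congr (P _); apply/seteqP; split => [w Aw|w].
    by rewrite -bigcup_seq; exists (J w) => //=; exact: mem_index_enum.
  by rewrite -bigcup_seq => -[i _ []].
- by move=> i; exact: measurableI.
- by apply/trivIsetP => i j _ _ ij; apply/seteqP;
    split => // w [[/= iw _] [/= jw _]]; rewrite -iw -jw eqxx in ij.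
Qed.

Lemma sum_label_prob : \sum_i label_prob i = 1.
Proof.
apply: EFin_inj;
  rewrite -sumEFin -(probability_setT P) (prob_labels measurableT).
by apply: eq_bigr => i _; rewrite label_probE setIT.
Qed.

Let HG := gaussian_coords_tuple R n.

Let mf : measurable_fun setT f := measurable_mixture HG _ _.

Let f_gt0 t : 0 < f t := mixture_gt0 _ _ _ label_prob_ge0 sum_label_prob.

Lemma distribution_mixture A : measurable A ->
  distribution P W A = (\int[mu]_(t in A) (f t)%:E)%E.
Proof.
move=> mA; rewrite /distribution /pushforward prob_labels; last first.
  by rewrite -[X in measurable X]setTI; exact: measurable_funPT.
rewrite (_ : (fun t => (f t)%:E) = fun t =>
  (\sum_i (label_prob i * gkernel coord (fun l => tnth (x i) l) t)%:E)%E);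
    last first.
  by apply/funext => t; rewrite sumEFin.
have mg i : measurable_fun setT (gkernel coord (fun l => tnth (x i) l)).
  exact: (measurable_gkernel HG).
rewrite ge0_integral_sum//; last 2 first.
- move=> i; apply: measurable_funTS; apply/measurable_EFinP.
  exact: measurable_realfun.measurable_funM.
- by move=> i t _; rewrite lee_fin mulr_ge0 ?label_prob_ge0 ?gkernel_ge0.
apply: eq_bigr => i _.
under eq_integral do rewrite EFinM.
rewrite ge0_integralZl//; first last.
- by rewrite lee_fin label_prob_ge0.
- by move=> t _; rewrite lee_fin gkernel_ge0.
- by apply: measurable_funTS; exact/measurable_EFinP.
pose a l := tnth (x i) l.
pose B := tshift a @^-1` A.
have mB : measurable B.
  by rewrite -[B]setTI; apply: measurable_tshift.
have -> : J @^-1` [set i] `&` W @^-1` A = J @^-1` [set i] `&` Z @^-1` B.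
  apply/seteqP; split => w [/= Jw AW]; split => //; move: AW;
    rewrite /B /= WE Jw;
    rewrite (_ : vadd _ _ = tshift a (Z w))//;
    by apply: eq_from_tnth => l; rewrite !tnth_mktuple addrC.
rewrite indepJ// label_probE; congr (_ * _)%E.
rewrite -[P (Z @^-1` B)]/(distribution P Z B) (gZ mB).
pose g t := (gkernel coord a t)%:E.
have mg' : measurable_fun setT g by apply/measurable_EFinP; exact: mg.
have mgA : measurable_fun setT (g \_ A).
  by apply/(measurable_restrictT _ mA); exact: measurable_funTS.
rewrite [LHS]integral_mkcond [RHS]integral_mkcond -[RHS](gc_inv HG a mgA);
  last first.
  by move=> t; rewrite patchE; case: ifP => // _; rewrite lee_fin gkernel_ge0.
apply: eq_integral => t _; rewrite !patchE.
rewrite (_ : (tshift a t \in A) = (t \in B)); last by apply/idP/idP;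
  rewrite !in_setE.
case: ifP => // _; congr (_%:E).
rewrite (gkernel_tr HG); apply: eq_bigr => l _.
by rewrite subrr subr0.
Qed.

Let domW : distribution P W `<< mu.
Proof.
apply/null_content_dominatesP => A mA A0; rewrite distribution_mixture//.
by apply: null_set_integral => //; apply: measurable_funTS;
  exact/measurable_EFinP.
Qed.

Lemma ae_density : ae_eq mu setT (density W) (EFin \o f).
Proof.
apply: integral_ae_eq => //.
- exact: Radon_Nikodym_integrable.
- exact/measurable_EFinP.
- by move=> A _ mA; rewrite -Radon_Nikodym_integral// -distribution_mixture.
Qed.

Lemma entropy_mixture : entropy W = (- (neg_entropy mu f)%:E)%E.
Proof.
rewrite /entropy; congr (- _)%E.
have Dfin t : density W t \is a fin_num by exact: Radon_Nikodym_fin_num.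
have mD : measurable_fun setT (density W).
  by apply: (measurable_int mu); exact: Radon_Nikodym_integrable.
have mF : measurable_fun setT (fine \o density W) by exact: measurableT_comp.
transitivity (\int[mu]_t (f t * ln (f t))%:E)%E.
  apply: ae_eq_integral => //.
  (* The density takes finite values, but it is not known to be positive
     everywhere; with [lne r = -oo] for [r <= 0], the product is [0] at [r = 0]
     and [+oo] for [r < 0]. *)
  - rewrite (_ : (fun t => _) = fun t =>
      if fine (density W t) == 0 then 0%E else
      if fine (density W t) < 0 then +oo%E else
      (fine (density W t) * ln (fine (density W t)))%:E).
      apply: measurable_fun_ifT => //.
        exact: measurable_fun_eqr.
      apply: measurable_fun_ifT => //.
        exact: measurable_fun_ltr.
      apply/measurable_EFinP; apply: measurable_realfun.measurable_funM => //.
      exact: measurableT_comp.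
    apply/funext => t; rewrite -[density W t]fineK//=.
    set r := fine _; case: ltgtP => r0.
    + by rewrite lt0_muleNy ?lte_fin.
    + by rewrite EFinM.
    + by rewrite r0 mul0e.
  - apply/measurable_EFinP; apply: measurable_realfun.measurable_funM => //.
    exact: measurableT_comp.
  - apply: filterS ae_density => t /= h /h ->.
    by rewrite lne_EFin.
rewrite /neg_entropy /Rintegral fineK//; apply: integrable_fin_num => //.
exact: (integrable_mixture_ln HG label_prob_ge0 sum_label_prob).
Qed.

End entropy_of_mixture.

(** * Comparison of the capacities *)

Lemma measurable_tuple_set1 (R : realType) (n : nat) (u : n.-tuple R) :
  measurable [set u].
Proof.
pose s (t : n.-tuple R) : R := \sum_i (tnth t i - tnth u i) ^+ 2.
have -> : [set u] = s @^-1` [set 0].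
  apply/seteqP; split => [t ->|t /= /eqP].
    by rewrite /s /= big1// => i _; rewrite subrr expr0n.
  rewrite psumr_eq0 => [/allP h|i _]; last exact: sqr_ge0.
  apply: eq_from_tnth => i; apply/eqP; rewrite -subr_eq0 -sqrf_eq0.
  exact: h (mem_index_enum i).
rewrite -[X in measurable X]setTI.
apply: (_ : measurable_fun setT s) => //.
apply: measurable_sum => i; apply: measurable_funX.
by apply: measurable_realfun.measurable_funB => //; exact: measurable_tnth.
Qed.

Theorem corollary1p8 (R : realType) (n k : nat) (x y : 'I_k -> n.-tuple R)
    (hxy : forall i j : 'I_k, eucl_dist (y i) (y j) <= eucl_dist (x i) (x j)) :
  (capacity (range y) <= capacity (range x))%E.
Proof.
apply: ge_ereal_sup => _ [d [T [P [X [Z [hX gZ indep ->]]]]]].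
(* A label of the input: [y] need not be injective, and [pick] makes the label
   depend on the value [X w] only.  The default of [odflt] is never used. *)
pose J w := odflt (projT1 (cid2 (hX w))) [pick i | y i == X w].
have yJ w : y (J w) = X w.
  rewrite /J; case: pickP => [i /eqP//|/= h].
  by case: cid2 => i _ /= e; have := h i; rewrite e eqxx.
have JE w w' : X w = X w' -> J w = J w'.
  move=> e; have eqp : [pick i | y i == X w] = [pick i | y i == X w']
    by rewrite e.
  rewrite /J eqp; case: pickP => [i _|h]; first by [].
  by have [i _ e'] := hX w'; have := h i; rewrite e' eqxx.
(* The event that the label is [i] is the preimage under [X] of the set [D i],
   which is empty if [i] is never picked. *)
pose D i := if `[< exists w, J w = i >] then [set y i] else set0.
have mD i : measurable (D i).
  by rewrite /D; case: ifP => // _; exact: measurable_tuple_set1.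
have DE i : J @^-1` [set i] = X @^-1` (D i).
  apply/seteqP; split => w /=.
    by move=> Jw; rewrite /D asboolT; [rewrite /= -Jw yJ|exists w].
  rewrite /D; case: asboolP => // -[w' <-] /= e.
  by apply: JE; rewrite e yJ.
have mX A : measurable A -> measurable (X @^-1` A).
  by move=> mA; rewrite -[X in measurable X]setTI; exact: measurable_funPT.
have mJ i : measurable (J @^-1` [set i]) by rewrite DE; exact: mX.
have indepJ i B : measurable B ->
    P (J @^-1` [set i] `&` Z @^-1` B) = (P (J @^-1` [set i]) * P (Z @^-1` B))%E.
  by move=> mB; rewrite DE; exact: indep.
pose U A := \bigcup_(i in [set i | A (x i)]) D i.
have mU A : measurable (U A).
  by apply: fin_bigcup_measurable => // i _; exact: mD.
have UE A : (fun w => x (J w)) @^-1` A = X @^-1` (U A).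
  apply/seteqP; split => w /=.
    move=> Aw; exists (J w) => //=.
    have : (J @^-1` [set J w]) w by [].
    by rewrite DE.
  move=> [i /= Ai Dw]; have : (X @^-1` D i) w by [].
  by rewrite -DE /= => ->.
have mX' : measurable_fun setT (fun w => x (J w)).
  by move=> _ A mA; rewrite setTI UE; exact: mX.
pose X' : {RV P >-> n.-tuple R} :=
  HB.pack_for {RV P >-> n.-tuple R} (fun w => x (J w))
  (isMeasurableFun.Build _ _ _ _ _ mX').
(* The competitor for [range x] has the same label and the same noise. *)
apply: (@le_trans _ _ (awgn_information X' Z)); last first.
  apply: ereal_sup_ubound; exists d, T, P, X', Z; split => //.
  move=> A B mA mB.
  by rewrite [X' @^-1` A]UE; exact: indep.
apply: leeD2r.
have eX w : rvadd X Z w = vadd (y (J w)) (Z w) by rewrite yJ.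
have eX' w : rvadd X' Z w = vadd (x (J w)) (Z w) by [].
rewrite (entropy_mixture eX gZ mJ indepJ) (entropy_mixture eX' gZ mJ indepJ).
rewrite leeN2 lee_fin.
apply: (neg_entropy_mixture_contraction (gaussian_coords_tuple R n)).
- exact: label_prob_ge0.
- exact: sum_label_prob.
- move=> i j; have := hxy i j; rewrite /eucl_dist ler_sqrt//.
  by apply: sumr_ge0 => l _; exact: sqr_ge0.
Qed.
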